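(* Let $T$ be an operator semigroup on a set $D$, let $S_a$ and $S_b$ be $T$-spaces, and let $R\subseteq S_a\times S_b$ be such that $\operatorname{Dom}R$ is a $T$-subspace of $S_a$. Then $R$ is a $T$-morphism from $\operatorname{Dom}R$ to $S_b$ if and only if $R\in\mathcal{T}_T(S_a\times S_b)$ and $R$ is a function.
   Context: An operator semigroup on a set $D$ is a set $T$ of functions $D\to D$ closed under composition. For $U\subseteq D$, $\langle U\rangle_T=\{f(u):f\in T,u\in U\}$; a $T$-space is a subset of $D$ of this form, and a $T$-subspace of a $T$-space $S$ is a $T$-space contained in $S$. A $T$-morphism from a $T$-space $S$ to a $T$-space is a map $\sigma$ with $\sigma(f(a))=f(\sigma(a))$ for all $a\in S$, $f\in T$. Binary relations are identified with their graphs; $\operatorname{Dom}R=\{x:\exists y,(x,y)\in R\}$, and $R$ is a function if for each $x\in\operatorname{Dom}R$ there is exactly one $y$ with $(x,y)\in R$. Let $T^*=T\cup\{\operatorname{Id}_D\}$ and $R_T(x,y)=\{(f(x),f(y)):f\in T^*\}$ for $(x,y)\in D\times D$. $\mathcal{T}_T(S_a\times S_b)$ is the topology on $S_a\times S_b$ generated by the subbasis $\{R_T(x,y):(x,y)\in S_a\times S_b\}$, i.e. the collection of all unions of finite intersections of members of this set. *)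

(* Defs.v *)
From mathcomp Require Import all_boot.
From mathcomp Require Export boolp classical_sets functions cardinality filter.

Set Implicit Arguments.
Unset Strict Implicit.
Unset Printing Implicit Defensive.

Local Open Scope classical_set_scope.

Definition operator_semigroup (D : Type) (T : set (D -> D)) : Prop :=
  forall f g, T f -> T g -> T (f \o g).

Definition T_span (D : Type) (T : set (D -> D)) (U : set D) : set D :=
  [set f u | f in T & u in U].

Definition T_space (D : Type) (T : set (D -> D)) (S : set D) : Prop :=
  exists U : set D, S = T_span T U.

Definition T_subspace (D : Type) (T : set (D -> D)) (S A : set D) : Prop :=
  T_space T A /\ A `<=` S.

(* A map from S to S' is represented by a total function on D sending S into
   S'; its values outside S are irrelevant, and since S' is a subset of D every
   map from S to S' extends to such a function. *)
Definition T_morphism (D : Type) (T : set (D -> D)) (S S' : set D)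
    (s : D -> D) : Prop :=
  [/\ T_space T S, T_space T S', set_fun S S' s
    & forall a f, S a -> T f -> s (f a) = f (s a)].

Definition graph_on (D : Type) (S : set D) (s : D -> D) : set (D * D) :=
  [set (x, s x) | x in S].

Definition relation_is_T_morphism (D : Type) (T : set (D -> D))
    (S S' : set D) (R : set (D * D)) : Prop :=
  exists2 s : D -> D, T_morphism T S S' s & R = graph_on S s.

Definition is_function (D : Type) (R : set (D * D)) : Prop :=
  forall x, R.`1 x -> exists! y, R (x, y).

Definition T_star (D : Type) (T : set (D -> D)) : set (D -> D) :=
  T `|` [set @id D].

Definition R_T (D : Type) (T : set (D -> D)) (x y : D) : set (D * D) :=
  [set (f x, f y) | f in T_star T].

Definition T_subbasis (D : Type) (T : set (D -> D)) (Sa Sb : set D) :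
    set (set (D * D)) :=
  [set R_T T x y | x in Sa & y in Sb].

(* The ambient set is Sa `*` Sb rather than D * D. Members of the subbasis are
   contained in it when Sa and Sb are T-spaces, so meeting with it only affects
   the empty intersection. *)
Definition T_basis (D : Type) (T : set (D -> D)) (Sa Sb : set D) :
    set (set (D * D)) :=
  [set (Sa `*` Sb) `&` B | B in finI_from (T_subbasis T Sa Sb) id].

Definition T_topology (D : Type) (T : set (D -> D)) (Sa Sb : set D) :
    set (set (D * D)) :=
  [set \bigcup_(B in F) B | F in [set F | F `<=` T_basis T Sa Sb]].

(* Main.v *)
Require Import Defs.
From mathcomp Require Import all_boot.

(** The open subsets of [Sa `*` Sb] are exactly the subsets stable under the
    diagonal action of [T] on pairs ([T_topologyP]).  Indeed each subbasic set
    [R_T T x y] is the orbit of [(x, y)], hence is stable when [T] is a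
    semigroup; so is [Sa `*` Sb], the empty intersection, because [T]-spaces are
    closed under [T]; and stability passes to intersections and unions.
    Conversely a stable set contains the orbit of each of its points, so it is a union of
    subbasic sets.

    For a function [R], stability says that [R (a, b)] implies
    [R (f a, f b)], that is [R (f a) = f (R a)]: this is the commutation
    condition defining a morphism. *)

Set Implicit Arguments.
Unset Strict Implicit.
Unset Printing Implicit Defensive.

Local Open Scope classical_set_scope.

Definition pair_stable (D : Type) (T : set (D -> D)) (A : set (D * D)) : Prop :=
  forall f x y, T f -> A (x, y) -> A (f x, f y).

Lemma T_space_stable (D : Type) (T : set (D -> D)) (S : set D) f x :
  operator_semigroup T -> T_space T S -> T f -> S x -> S (f x).
Proof.
move=> semiT [U ->] Tf [g Tg [u Uu <-]].
by exists (f \o g); [exact: semiT | exists u].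
Qed.

Lemma pair_stableX (D : Type) (T : set (D -> D)) (Sa Sb : set D) :
  operator_semigroup T -> T_space T Sa -> T_space T Sb ->
  pair_stable T (Sa `*` Sb).
Proof.
move=> semiT spa spb f x y Tf [/= Sx Sy].
by split; [exact: T_space_stable Tf Sx | exact: T_space_stable Tf Sy].
Qed.

Lemma pair_stable_R_T (D : Type) (T : set (D -> D)) (x y : D) :
  operator_semigroup T -> pair_stable T (R_T T x y).
Proof.
move=> semiT f _ _ Tf [g Tg [<- <-]]; exists (f \o g) => //; left.
by case: Tg => [Tg|->]; first exact: semiT.
Qed.

Lemma R_T_refl (D : Type) (T : set (D -> D)) (x y : D) : R_T T x y (x, y).
Proof. by exists id => //; right. Qed.

Lemma R_T_sub (D : Type) (T : set (D -> D)) (A : set (D * D)) x y :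
  pair_stable T A -> A (x, y) -> R_T T x y `<=` A.
Proof. by move=> stA Axy _ [f [Tf|->] <-] //; exact: stA. Qed.

Lemma pair_stable_basis (D : Type) (T : set (D -> D)) (Sa Sb : set D) B :
  operator_semigroup T -> T_space T Sa -> T_space T Sb ->
  T_basis T Sa Sb B -> pair_stable T B.
Proof.
move=> semiT spa spb [_ [F subF <-] <-] f x y Tf [Sxy Fxy].
split; first exact: pair_stableX Tf Sxy.
move=> C FC; have := Fxy C FC; have /set_mem [u _ [v _ <-]] := subF C FC.
exact: pair_stable_R_T.
Qed.

(** Openness is a pointwise condition because the orbit of a point is its
    smallest neighbourhood: every open set containing it contains that orbit. *)
Lemma T_topologyP (D : Type) (T : set (D -> D)) (Sa Sb : set D) R :
  operator_semigroup T -> T_space T Sa -> T_space T Sb ->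
  R `<=` Sa `*` Sb -> T_topology T Sa Sb R <-> pair_stable T R.
Proof.
move=> semiT spa spb subR; split.
  move=> [F subF <-] f x y Tf [B FB Bxy]; exists B => //.
  exact: (pair_stable_basis semiT spa spb (subF B FB)) Tf Bxy.
move=> stR; exists [set B | T_basis T Sa Sb B /\ B `<=` R] => [B []//|].
apply/seteqP; split => [p [B [_ BR] /BR]//|[x y] Rxy].
have [Sx Sy] := subR _ Rxy.
exists ((Sa `*` Sb) `&` R_T T x y); last by split; [|exact: R_T_refl].
split; last by move=> p [_]; exact: R_T_sub.
by exists (R_T T x y) => //; apply: (@finI_from1 _ _ _ id); exists x => //; exists y.
Qed.

Theorem theorem7p4p6 (D : Type) (T : set (D -> D)) (Sa Sb : set D)
    (R : set (D * D)) :
  operator_semigroup T ->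
  T_space T Sa ->
  T_space T Sb ->
  R `<=` Sa `*` Sb ->
  T_subspace T Sa R.`1 ->
  relation_is_T_morphism T R.`1 Sb R <->
  (T_topology T Sa Sb R /\ is_function R).
Proof.
move=> semiT spa spb subR [spR _].
rewrite (T_topologyP semiT spa spb subR); split.
  move=> [s [_ _ _ sM] RE].
  have RP x y : R (x, y) <-> R.`1 x /\ y = s x.
    by rewrite {1}RE; split=> [[z ? [<- <-]]//|[? ->]]; exists x.
  split=> [f x y Tf /RP[Rx ->]|x Rx].
    by apply/RP; rewrite sM//; split=> //; exact: T_space_stable Tf Rx.
  by exists (s x); split=> [|y /RP[]//]; apply/RP.
move=> [stR funR].
(* Off the domain any value will do; taking x itself also covers empty D. *)
have /choice[s sR] x : exists y, R.`1 x -> R (x, y).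
  have [[y Rxy]|nRx] := pselect (R.`1 x); first by exists y.
  by exists x.
have sE x y : R (x, y) -> s x = y.
  move=> Rxy; have Rx : R.`1 x by exists y.
  have [z [_ zU]] := funR x Rx.
  by rewrite -(zU _ Rxy) -(zU _ (sR x Rx)).
exists s; first split=> //.
- by move=> x /sR/subR[].
- by move=> a f Ra Tf; apply/sE/stR => //; exact: sR.
apply/seteqP; split=> [[x y] Rxy|_ [x Rx <-]]; last exact: sR.
by exists x; [exists y | rewrite (sE x y)].
Qed.
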